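(* Let $l=9$, $r\in\{1,2,4\}$ and $a=[r]$. Then $p_{32,0}(1/a)$ and $p_{64,16}(1/a)$ are in $S$.
   Context: For an integer $i$, $[i]=\sum x^{n^2}\in\mathbb{Z}/2[[x]]$, summed over $n\in\mathbb{Z}$ with $n\equiv i\pmod 9$. $S$ is the subring of $\mathbb{Z}/2[[x]]$ generated over $\mathbb{Z}/2$ by $[1],[2],[3],[4]$. $1/a$ is taken in the field $L$ of Laurent series over $\mathbb{Z}/2$. For $q$ a power of $2$ and $0\le j<q$, $p_{q,j}:L\to L$ is $\sum_n c_nx^n\mapsto\sum_{n\equiv j\pmod q}c_nx^n$. *)

(* Defs.v *)
From HB Require Import structures.
From mathcomp Require Import all_boot all_order all_algebra.
From mathcomp Require Import boolp classical_sets functions cardinality fsbigop.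
From mathcomp Require Import zify ring.

Set Implicit Arguments.
Unset Strict Implicit.
Unset Printing Implicit Defensive.

Import Order.TTheory GRing.Theory Num.Theory.
Local Open Scope classical_set_scope.
Local Open Scope ring_scope.

(* Formal Laurent series over a field K: coefficient functions on int that
   vanish below some (possibly negative) exponent. *)
Section LaurentSeries.
Variable K : fieldType.

Definition bounded_below (f : int -> K) : Prop :=
  exists a : int, forall n : int, n < a -> f n = 0.

Record laurent := Laurent {
  lcoef :> int -> K;
  lcoefP : bounded_below lcoef }.

HB.instance Definition _ := gen_eqMixin laurent.
HB.instance Definition _ := gen_choiceMixin laurent.

Lemma laurentP (f g : laurent) : f =1 g -> f = g.
Proof.
case: f g => [f fP] [g gP] /= /funext fg; subst g.
by congr Laurent; exact: Prop_irrelevance.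
Qed.

Definition vanish_lt (a : int) (f : int -> K) := forall n : int, n < a -> f n = 0.

Lemma vanish_le (a b : int) f : b <= a -> vanish_lt a f -> vanish_lt b f.
Proof. by move=> ba fa n nb; apply: fa; apply: lt_le_trans nb ba. Qed.

Definition const_fun (c : K) : int -> K := fun n => if n == 0 then c else 0.

Lemma const_vanish c : vanish_lt 0 (const_fun c).
Proof. by move=> n n0; rewrite /const_fun lt_eqF. Qed.

Definition lconst (c : K) : laurent := Laurent (ex_intro _ 0 (@const_vanish c)).

Lemma ladd_subproof (f g : laurent) : bounded_below (fun n => f n + g n).
Proof.
case: f g => [f [a fa]] [g [b gb]] /=; exists (Order.min a b) => n.
by rewrite lt_min => /andP[na nb]; rewrite fa ?gb ?addr0.
Qed.
Definition ladd (f g : laurent) : laurent := Laurent (ladd_subproof f g).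

Lemma lopp_subproof (f : laurent) : bounded_below (fun n => - f n).
Proof. by case: f => [f [a fa]] /=; exists a => n na; rewrite fa ?oppr0. Qed.
Definition lopp (f : laurent) : laurent := Laurent (lopp_subproof f).

Lemma lscale_subproof (c : K) (f : laurent) : bounded_below (fun n => c * f n).
Proof. by case: f => [f [a fa]] /=; exists a => n na; rewrite fa ?mulr0. Qed.
Definition lscale (c : K) (f : laurent) : laurent :=
  Laurent (lscale_subproof c f).

(* The family summed here has finite support when f and g are bounded below. *)
Definition conv (f g : int -> K) (n : int) : K :=
  \sum_(i \in [set: int]) f i * g (n - i).

Lemma conv_vanish a b f g :
  vanish_lt a f -> vanish_lt b g -> vanish_lt (a + b) (conv f g).
Proof.
move=> fa gb n nab; apply: fsbig1 => i _.
have [ia|ai] := ltP i a; first by rewrite fa ?mul0r.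
by rewrite gb ?mulr0//; lia.
Qed.

Lemma lmul_subproof (f g : laurent) : bounded_below (conv f g).
Proof.
case: f g => [f [a fa]] [g [b gb]] /=.
by exists (a + b); exact: conv_vanish.
Qed.
Definition lmul (f g : laurent) : laurent := Laurent (lmul_subproof f g).

Lemma conv_sum a b f g (k : nat) : vanish_lt a f -> vanish_lt b g ->
  conv f g (a + b + k%:Z) =
  \sum_(i < k.+1) f (a + i%:Z) * g (b + (k - i)%N%:Z).
Proof.
move=> fa gb; rewrite /conv fsbig_supp.
rewrite (@fsbig_fwiden _ _ _ _ [seq a + i%:Z | i <- iota 0 k.+1]); first last.
- by move=> i [_]; apply: contra_notP => Hi; split.
- by rewrite map_inj_uniq ?iota_uniq// => i j; lia.
- move=> i [_ /= Hi]; rewrite /mkset.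
  have ai : a <= i.
    by rewrite leNgt; apply/negP => /fa f0; apply: Hi; rewrite f0 mul0r.
  have ib : b <= a + b + k%:Z - i.
    by rewrite leNgt; apply/negP => /gb g0; apply: Hi; rewrite g0 mulr0.
  have : `|i - a|%N \in iota 0 k.+1 by rewrite mem_iota; lia.
  move=> /(map_f (fun j : nat => a + j%:Z)).
  by have -> : a + `|i - a|%N%:Z = i by lia.
rewrite big_map -(big_mkord xpredT (fun i => f (a + i%:Z) * g (b + (k - i)%N%:Z))).
rewrite /index_iota subn0 !big_seq; apply: eq_bigr => i.
rewrite mem_iota => ik; congr (_ * g _); lia.
Qed.

Definition trunc (a : int) (m : nat) (f : int -> K) : {poly K} :=
  \poly_(i < m) f (a + i%:Z).

Lemma conv_coef a b f g (k m : nat) : vanish_lt a f -> vanish_lt b g ->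
  (k < m)%N -> conv f g (a + b + k%:Z) = (trunc a m f * trunc b m g)`_k.
Proof.
move=> fa gb km; rewrite (conv_sum _ fa gb) coefM; apply: eq_bigr => i _.
by rewrite !coef_poly !ifT//; have := ltn_ord i; lia.
Qed.

Lemma coefM_eq (p q p' q' : {poly K}) (k : nat) :
  (forall i, (i <= k)%N -> p`_i = p'`_i) ->
  (forall i, (i <= k)%N -> q`_i = q'`_i) -> (p * q)`_k = (p' * q')`_k.
Proof.
move=> pp qq; rewrite !coefM; apply: eq_bigr => i _.
by rewrite pp ?qq//; have := ltn_ord i; lia.
Qed.

Lemma trunc_conv a b f g (i m : nat) : vanish_lt a f -> vanish_lt b g ->
  (i < m)%N ->
  (trunc (a + b) m (conv f g))`_i = (trunc a m f * trunc b m g)`_i.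
Proof. by move=> fa gb im; rewrite coef_poly im; exact: conv_coef. Qed.

Lemma vanish_ext a (f g : int -> K) : vanish_lt a f -> vanish_lt a g ->
  (forall k : nat, f (a + k%:Z) = g (a + k%:Z)) -> f =1 g.
Proof.
move=> fa ga fg n; have [na|an] := ltP n a; first by rewrite fa ?ga.
have -> : n = a + `|n - a|%N%:Z by lia.
exact: fg.
Qed.

Lemma lmulC : commutative lmul.
Proof.
case=> [f [a fa]] [g [b gb]]; apply: laurentP => /=.
apply: (@vanish_ext (a + b)); first exact: conv_vanish.
  by rewrite addrC; exact: conv_vanish.
move=> k; rewrite (conv_coef fa gb (ltnSn k)) mulrC.
by rewrite (addrC a) (conv_coef gb fa (ltnSn k)).
Qed.

Lemma lmulA : associative lmul.
Proof.
case=> [f [a fa]] [g [b gb]] [h [c hc]]; apply: laurentP => /=.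
have fg := conv_vanish fa gb; have gh := conv_vanish gb hc.
apply: (@vanish_ext (a + (b + c))); first exact: conv_vanish.
  by rewrite addrA; exact: conv_vanish.
move=> k; rewrite (conv_coef fa gh (ltnSn k)).
rewrite addrA (conv_coef fg hc (ltnSn k)).
transitivity ((trunc a k.+1 f * (trunc b k.+1 g * trunc c k.+1 h))`_k).
  by apply: coefM_eq => // i ik; exact: trunc_conv.
rewrite mulrA; apply: coefM_eq => // i ik.
by rewrite trunc_conv.
Qed.

Lemma conv_const c (g : laurent) n : conv (const_fun c) g n = c * g n.
Proof.
rewrite /conv fsbig_supp (@fsbig_fwiden _ _ _ _ [:: 0]); first last.
- by move=> i [_]; apply: contra_notP => Hi; split.
- by [].
- move=> i [_ /= Hi]; rewrite inE; apply/negPn/negP => /negPf i0.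
  by apply: Hi; rewrite /const_fun i0 mul0r.
by rewrite big_seq1 /const_fun eqxx subr0.
Qed.

Lemma lmul_const c (g : laurent) : lmul (lconst c) g = lscale c g.
Proof. by apply: laurentP => n; exact: conv_const. Qed.

Lemma lmulDl : left_distributive lmul ladd.
Proof.
move=> [f [a fa]] [g [b gb]] [h [c hc]]; apply: laurentP => /=.
pose d := Order.min a b.
have fd : vanish_lt d f by apply: vanish_le fa; rewrite ge_min lexx.
have gd : vanish_lt d g by apply: vanish_le gb; rewrite ge_min lexx orbT.
have fgd : vanish_lt d (fun n => f n + g n).
  by move=> n nd; rewrite fd ?gd ?addr0.
apply: (@vanish_ext (d + c)); first exact: conv_vanish.
  by move=> n nd; rewrite !(conv_vanish _ hc nd) ?addr0.
move=> k; rewrite !(conv_sum _ _ hc)// -big_split/=.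
by apply: eq_bigr => i _; rewrite mulrDl.
Qed.

Fact laddA : associative ladd.
Proof. by move=> f g h; apply: laurentP => n /=; rewrite addrA. Qed.
Fact laddC : commutative ladd.
Proof. by move=> f g; apply: laurentP => n /=; rewrite addrC. Qed.
Fact ladd0 : left_id (lconst 0) ladd.
Proof.
by move=> f; apply: laurentP => n /=; rewrite /const_fun if_same add0r.
Qed.
Fact laddN : left_inverse (lconst 0) lopp ladd.
Proof.
by move=> f; apply: laurentP => n /=; rewrite /const_fun if_same addNr.
Qed.

HB.instance Definition _ :=
  GRing.isZmodule.Build laurent laddA laddC ladd0 laddN.

Fact lmul1 : left_id (lconst 1) lmul.
Proof. by move=> f; rewrite lmul_const; apply: laurentP => n /=; rewrite mul1r. Qed.
Fact lone_neq0 : lconst 1 != 0.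
Proof.
apply/eqP => /(congr1 (fun f : laurent => f 0)); rewrite /= /const_fun eqxx.
by move/eqP; rewrite oner_eq0.
Qed.

HB.instance Definition _ := GRing.Zmodule_isComNzRing.Build laurent
  lmulA lmulC lmul1 lmulDl lone_neq0.

Fact lscaleA a b (f : laurent) : lscale a (lscale b f) = lscale (a * b) f.
Proof. by apply: laurentP => n /=; rewrite mulrA. Qed.
Fact lscale1 : left_id 1 lscale.
Proof. by move=> f; apply: laurentP => n /=; rewrite mul1r. Qed.
Fact lscaleDr : right_distributive lscale +%R.
Proof. by move=> c f g; apply: laurentP => n /=; rewrite mulrDr. Qed.
Fact lscaleDl f : {morph lscale^~ f : a b / a + b}.
Proof. by move=> a b; apply: laurentP => n /=; rewrite mulrDl. Qed.

HB.instance Definition _ := GRing.Zmodule_isLmodule.Build K laurent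
  lscaleA lscale1 lscaleDr lscaleDl.

Fact lscaleAl (a : K) (f g : laurent) : a *: (f * g) = (a *: f) * g.
Proof.
have sc c h : c *: h = lconst c * h :> laurent by exact/esym/lmul_const.
by rewrite !sc mulrA.
Qed.

HB.instance Definition _ := GRing.Lmodule_isLalgebra.Build K laurent lscaleAl.

(* First n coefficients of the inverse of the power series with coefficients u,
   solving \sum_(i <= k) w i * u (k - i) = (k == 0) for w k. *)
Fixpoint inv_seq (u : nat -> K) (n : nat) : seq K :=
  if n is m.+1 then
    let s := inv_seq u m in
    rcons s (((m == 0%N)%:R - \sum_(i < m) s`_i * u (m - i)%N) / u 0%N)
  else [::].

Lemma size_inv_seq u n : size (inv_seq u n) = n.
Proof. by elim: n => //= n IH; rewrite size_rcons IH. Qed.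

Lemma nth_inv_seq u n i : (i < n)%N ->
  (inv_seq u n)`_i = (inv_seq u i.+1)`_i.
Proof.
elim: n => // n IH; rewrite ltnS leq_eqVlt => /predU1P[-> //|lin].
by rewrite [LHS]/= nth_rcons size_inv_seq lin IH.
Qed.

Lemma inv_seqP u k : u 0%N != 0 ->
  \sum_(i < k.+1) (inv_seq u i.+1)`_i * u (k - i)%N = (k == 0%N)%:R.
Proof.
move=> u0; rewrite big_ord_recr /= subnn nth_rcons size_inv_seq ltnn eqxx.
rewrite divfK// addrCA -sumrB big1 ?addr0// => i _.
by rewrite [X in _ - X * _]nth_inv_seq ?subrr.
Qed.

Lemma laurent_val (f : laurent) : f != 0 ->
  exists2 v : int, vanish_lt v f & f v != 0.
Proof.
move=> fN0; case: (lcoefP f) => a fa.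
have [/existsNP[n fn]|] := pselect (~ forall k : nat, f (a + k%:Z) = 0); last first.
  move/contrapT => f0; case/eqP: fN0; apply: laurentP => /=.
  apply: (@vanish_ext a) => //; first by move=> n _; rewrite /const_fun if_same.
  by move=> k; rewrite f0 /const_fun if_same.
have ex : exists k : nat, f (a + k%:Z) != 0 by exists n; exact/eqP.
exists (a + (ex_minn ex)%:Z); last by case: ex_minnP.
case: ex_minnP => k _ kmin m mk.
have [ma|am] := ltP m a; first exact: fa.
apply/eqP/negPn/negP => fm.
have := kmin `|m - a|%N; have -> : a + `|m - a|%N%:Z = m by lia.
by move=> /(_ fm); lia.
Qed.

Lemma laurent_inv_ex (f : laurent) : f != 0 -> exists g : laurent, g * f = 1.
Proof.
move=> /laurent_val[v fv fv0].
pose u (i : nat) := f (v + i%:Z).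
pose w (n : int) : K :=
  if n < - v then 0 else (inv_seq u (absz (n + v)).+1)`_(absz (n + v)).
have wv : vanish_lt (- v) w by move=> n; rewrite /w => ->.
exists (Laurent (ex_intro _ (- v) wv)); apply: laurentP => /=.
apply: (@vanish_ext (- v + v)); first exact: conv_vanish.
  by rewrite addNr; exact: const_vanish.
move=> k; rewrite (conv_sum _ wv fv) addNr add0r.
transitivity ((k == 0%N)%:R : K); last first.
  by rewrite /const_fun eqz_nat; case: eqP.
rewrite -(@inv_seqP u k); last by rewrite /u addr0.
apply: eq_bigr => i _; congr (_ * _).
rewrite /w ifF; last by lia.
by have -> : absz (- v + i%:Z + v) = i by lia.
Qed.

Definition linv (f : laurent) : laurent := xget 0 [set g | g * f = 1].

Fact lmulVf (f : laurent) : f != 0 -> linv f * f = 1.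
Proof. by move=> /laurent_inv_ex /(xgetPex 0). Qed.

Fact linv0 : linv 0 = 0.
Proof.
by apply: xgetPN => g /eqP; rewrite mulr0 eq_sym oner_eq0.
Qed.

HB.instance Definition _ := GRing.ComNzRing_isField.Build laurent lmulVf linv0.

Lemma pr_subproof (q j : nat) (f : laurent) :
  bounded_below (fun n => if (n == j %[mod q])%Z then f n else 0).
Proof.
by case: (lcoefP f) => a fa; exists a => n na; rewrite fa ?if_same.
Qed.

Definition pr (q j : nat) (f : laurent) : laurent := Laurent (pr_subproof q j f).

Definition alg_gen (G : set laurent) : set laurent :=
  smallest [set A : set laurent | subalg_closed [in A]] G.

(* [i] modulo l: the sum of x^(n^2) over n in int with n = i mod l; the
   coefficient of x^m counts the n, positive or negative, with n^2 = m. *)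
Definition theta_coef (l i m : int) : K :=
  \sum_(n \in [set n : int | (n = i %[mod l])%Z /\ n ^+ 2 = m]) (1 : K).

Lemma theta_vanish l i : vanish_lt 0 (theta_coef l i).
Proof.
move=> m m0; apply: fsbig1 => n [_ nm].
by move: m0; rewrite -nm ltNge sqr_ge0.
Qed.

Lemma theta_finite (l i m : int) :
  finite_set [set n : int | (n = i %[mod l])%Z /\ n ^+ 2 = m].
Proof.
apply: (@sub_finite_set _ _ [set` [seq j%:Z - m | j <- iota 0 `|m + m|.+1]]).
  move=> n [_ nm]; rewrite /mkset.
  have : absz (n + m) \in iota 0 `|m + m|.+1 by rewrite mem_iota; nia.
  move=> /(map_f (fun j : nat => j%:Z - m)).
  by have -> : (absz (n + m))%:Z - m = n by nia.
exact: finite_seq.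
Qed.

Definition theta (l i : int) : laurent :=
  Laurent (ex_intro _ 0 (@theta_vanish l i)).

(* The subring K[[x]] of the field of Laurent series. *)
Definition power_series : set laurent := [set f | vanish_lt 0 f].

Lemma theta_power_series l i : power_series (theta l i).
Proof. exact: theta_vanish. Qed.

Lemma alg_gen_power_series (G : set laurent) :
  G `<=` power_series -> alg_gen G `<=` power_series.
Proof.
move=> Gp; apply: smallest_sub => //; split.
- by rewrite !inE; exact: const_vanish.
- move=> c f g; rewrite !inE => f0 g0 n n0.
  by rewrite /= f0 ?g0 ?mulr0 ?addr0.
- move=> f g; rewrite !inE => f0 g0.
  by rewrite /power_series /= -[0]addr0; exact: conv_vanish.
Qed.

End LaurentSeries.

Definition L := laurent 'F_2.

Definition br (i : int) : L := theta 'F_2 9 i.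

Definition Sring : set L := alg_gen [set br 1; br 2; br 3; br 4].

Lemma Sring_power_series : Sring `<=` @power_series 'F_2.
Proof.
apply: alg_gen_power_series => f /= H.
by case: H => [[[]|]|] ->; exact: theta_power_series.
Qed.

(* Main.v *)
(* In characteristic 2 the p_{q,j} are determined by repeated halving: if
   p_{2,0}(f) = g^2 then p_{2q,2j}(f) = p_{q,j}(g)^2.  Write A, B, C, D for [r],
   [2r], [4r], [3].  The even part of [2i] is [i]^4, and the substitution
   (u, v) = (a + b, a - b) in u^2 + v^2 expresses the product of the odd parts of
   [2i] and [2j] by [i + j]^2 [i - j]^2 and [i]^4 [j]^4.  With these relations
   and the cubic D + D^2 + D^3 = A^2 C + A B^2 + B C^2, halving 1/A five times
   gives in turn C^2/A, C^3/A, BCD/A, G/A with G = D (B^2 C + A C^2 + A^2 B), and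
   finally the polynomial B C^3 + B^4 + A^3 B; moreover p_{4,1}(G/A) is the
   polynomial C^2 D^3 + A B^2 C^2 + C^2 D^6 + B^2 C^6.  Hence
   p_{32,0}(1/A) and p_{64,16}(1/A) are a 32nd and a 16th power of elements of S. *)
Require Import Defs.
From mathcomp Require Import all_boot all_order all_algebra.
From mathcomp Require Import boolp classical_sets functions cardinality fsbigop.
From mathcomp Require Import zify ring.

Set Implicit Arguments.
Unset Strict Implicit.
Unset Printing Implicit Defensive.

Import Order.TTheory GRing.Theory Num.Theory.
Local Open Scope ring_scope.

(** * Projections onto residue classes *)

Lemma eqz_mod_mull q d (m n : int) :
  (m == n %[mod (q * d)%N])%Z -> (m == n %[mod q])%Z.
Proof.
by rewrite !eqz_mod_dvd; apply: dvdz_trans; rewrite PoszM dvdz_mulr.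
Qed.

Section Projections.
Variable K : fieldType.
Implicit Types f g : laurent K.

Lemma pr0 q j : pr q j (0 : laurent K) = 0.
Proof. by apply: laurentP => n /=; rewrite /const_fun !if_same. Qed.

Lemma prD q j f g : pr q j (f + g) = pr q j f + pr q j g.
Proof. by apply: laurentP => n /=; case: ifP; rewrite ?addr0. Qed.

Lemma pr_mod q j f : pr q (j %% q) f = pr q j f.
Proof. by apply: laurentP => n /=; rewrite -modz_nat modz_mod. Qed.

Lemma pr_pr q i j f :
  pr q j (pr q i f) = if i == j %[mod q] then pr q i f else 0.
Proof.
apply: laurentP => n; rewrite (fun_if (fun h : laurent K => h n)) /=.
rewrite /const_fun if_same -eqz_nat -!modz_nat.
have [ij|ij] := eqVneq (i%:Z %% q)%Z (j%:Z %% q)%Z.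
  by rewrite ij /=; case: ifP => // ->.
by rewrite /=; case: ifP => // /eqP->; rewrite eq_sym (negPf ij).
Qed.

Lemma sum_pr q f : (0 < q)%N -> f = \sum_(i < q) pr q i f.
Proof.
move=> q0; apply: laurentP => n.
have [r rq nr] : exists2 r, (r < q)%N & (n %% q)%Z = r.
  by exists (absz (n %% q)%Z); lia.
have nE i : (n == i%:Z %[mod q])%Z = (r == i %% q)%N by rewrite nr modz_nat.
rewrite (bigD1 (Ordinal rq)) //=.
rewrite nE modn_small // eqxx.
rewrite (_ : lcoef (\sum_(i < q | i != Ordinal rq) pr q i f) n = 0) ?addr0 //.
elim/big_rec: _ => /= [|i g iN g0]; first by rewrite /const_fun if_same.
by rewrite g0 addr0 nE modn_small // eq_sym -[r]/(val (Ordinal rq)) val_eqE (negPf iN).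
Qed.

(** If [f m] is nonzero then m lies in class i, so n lies in class i + j exactly when n - m lies in
    class j; other terms of the convolution vanish. *)
Lemma pr_homM q i j f g : pr q i f = f -> pr q (i + j) (f * g) = f * pr q j g.
Proof.
move=> fi.
have f0 m : (m != i %[mod q])%Z -> f m = 0.
  by rewrite -[f]fi /= => /negPf->.
have shift n m : (m == i %[mod q])%Z ->
    (n == (i + j)%N %[mod q])%Z = (n - m == j %[mod q])%Z.
  rewrite !eqz_mod_dvd => qm.
  have -> : n - (i + j)%N%:Z = n - m - j%:Z + (m - i%:Z) by lia.
  by rewrite rpredDr.
apply: laurentP => n /=.
case: ifP => nij; last apply/esym/fsbig1; last move=> m _ /=.
  apply: eq_fsbigr => m _ /=.
  have [mi|/f0->] := boolP (m == i %[mod q])%Z; last by rewrite !mul0r.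
  by rewrite -(shift _ _ mi) nij.
have [mi|/f0->] := boolP (m == i %[mod q])%Z; last by rewrite !mul0r.
by rewrite -(shift _ _ mi) nij mulr0.
Qed.

(** The grading by Z/q: [(j + (q - i)) %% q] is j - i modulo q, written with natural numbers. *)
Lemma prM q j f g : (0 < q)%N ->
  pr q j (f * g) = \sum_(i < q) pr q i f * pr q ((j + (q - i)) %% q) g.
Proof.
move=> q0; rewrite {1}(sum_pr f q0) mulr_suml.
rewrite (big_morph (pr q j) (prD q j) (pr0 q j)); apply: eq_bigr => i _.
rewrite pr_mod -(@pr_homM q i) ?pr_pr ?eqxx //.
by rewrite -[LHS]pr_mod -[RHS]pr_mod addnCA subnKC ?modnDr // ltnW.
Qed.

Lemma pr20M f g :
  pr 2 0 (f * g) = pr 2 0 f * pr 2 0 g + pr 2 1 f * pr 2 1 g.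
Proof. by rewrite prM // !big_ord_recl big_ord0 addr0. Qed.

Lemma pr21M f g :
  pr 2 1 (f * g) = pr 2 0 f * pr 2 1 g + pr 2 1 f * pr 2 0 g.
Proof. by rewrite prM // !big_ord_recl big_ord0 addr0. Qed.

Lemma pr41M f g : pr 4 1 (f * g) = pr 4 0 f * pr 4 1 g + pr 4 1 f * pr 4 0 g
  + pr 4 2 f * pr 4 3 g + pr 4 3 f * pr 4 2 g.
Proof. by rewrite prM // !big_ord_recl big_ord0 addr0 /= !addrA. Qed.

Lemma pr43M f g : pr 4 3 (f * g) = pr 4 0 f * pr 4 3 g + pr 4 3 f * pr 4 0 g
  + pr 4 1 f * pr 4 2 g + pr 4 2 f * pr 4 1 g.
Proof.
rewrite prM // !big_ord_recl big_ord0 addr0 /=; set u := _ * _; rewrite -!addrA.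
by congr (u + _); rewrite !addrA addrC addrA.
Qed.

Lemma pr_dvd q d j f : pr (q * d) j (pr q j f) = pr (q * d) j f.
Proof.
by apply: laurentP => n /=; case: ifP => // /eqz_mod_mull->.
Qed.

Lemma pr_sub q d i f : pr q i (pr (q * d) i f) = pr (q * d) i f.
Proof.
apply: laurentP => n /=; case: ifPn => // ni; rewrite ifF //.
by apply: contraNF ni => /eqz_mod_mull.
Qed.

Lemma coefM_bottom a b f g : vanish_lt a f -> vanish_lt b g ->
  (f * g) (a + b) = f a * g b.
Proof.
move=> fa gb; rewrite -[a + b]addr0 [LHS](@conv_sum _ a b f g 0 fa gb).
by rewrite big_ord1 !addr0.
Qed.

End Projections.

(** * Squaring and halving over F_2 *)

Lemma F2_sqr (c : 'F_2) : c ^+ 2 = c.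
Proof. by case: c => -[|[|//]] i; apply/val_inj. Qed.

Lemma F2_two : 2%:R = 0 :> 'F_2.
Proof. exact/val_inj. Qed.

Lemma L_two : 2%:R = 0 :> L.
Proof.
apply: laurentP => n; rewrite mulr2n /= /const_fun; case: ifP => _.
  exact/val_inj.
by rewrite addr0.
Qed.

(** Frobenius: cross terms are even and coefficients are their own squares, so squaring only doubles
    exponents. *)
Lemma polyF2_sqr (p : {poly 'F_2}) (k : nat) :
  (p ^+ 2)`_k = if odd k then 0 else p`_k./2.
Proof.
elim/poly_ind: p k => [|p c IH] k.
  by rewrite expr2 mul0r !coef0 if_same.
have -> : (p * 'X + c%:P) ^+ 2 = p ^+ 2 * 'X^2 + c%:P.
  rewrite sqrrD exprMn -polyC_exp F2_sqr -mulr_natr.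
  by rewrite -polyC_natr F2_two polyC0 mulr0 addr0.
rewrite coefD coefMXn coefC coefD coefMX coefC IH.
case: k => [|[|k]] //=; first by rewrite addr0.
by rewrite negbK subn2 /= !addr0.
Qed.

Lemma sqr_coef (f : L) (n : int) :
  (f ^+ 2) n = if (n == 0 %[mod 2])%Z then f (n %/ 2)%Z else 0.
Proof.
case: (lcoefP f) => a fa.
have [nlt|] := ltP n (a + a).
  rewrite expr2 /= (conv_vanish fa fa) //.
  by case: ifP => // /eqP n2; rewrite fa //; lia.
(* The offset [a + a] is even, so [n] and [k] have the same parity and the polynomial case
   transfers. *)
move=> an; pose k := absz (n - (a + a))%R.
have nE : n = a + a + k%:Z by rewrite /k; lia.
rewrite [in LHS]nE expr2 /= (conv_coef fa fa (ltnSn k)) -expr2 polyF2_sqr.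
case: ifP => ko; case: ifP => // /eqP n2; [lia| |lia].
rewrite coef_poly ifT; last by lia.
by congr (lcoef f _); lia.
Qed.

Lemma pr_sqr q j (f : L) : pr (2 * q) (2 * j) (f ^+ 2) = (pr q j f) ^+ 2.
Proof.
apply: laurentP => n; rewrite sqr_coef.
transitivity (if (n == (2 * j)%N %[mod (2 * q)%N])%Z then (f ^+ 2) n else 0) => //.
rewrite sqr_coef.
have [n2|n2] := boolP (n == 0 %[mod 2])%Z; last by rewrite if_same.
have nE : n = 2 * (n %/ 2)%Z by move/eqP: n2; lia.
rewrite {1}nE !PoszM -!mulz_modr //=.
by rewrite (inj_eq (mulfI _)).
Qed.

Lemma pr20_sqr (f : L) : pr 2 0 (f ^+ 2) = f ^+ 2.
Proof.
apply: laurentP => n.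
transitivity (if (n == 0 %[mod 2])%Z then (f ^+ 2) n else 0) => //.
by rewrite sqr_coef; case: (n == 0 %[mod 2])%Z.
Qed.

Lemma pr21_sqr (f : L) : pr 2 1 (f ^+ 2) = 0.
Proof. by rewrite -pr20_sqr pr_pr. Qed.

Lemma L_addxx (f : L) : f + f = 0.
Proof. by rewrite -mulr2n -mulr_natr L_two mulr0. Qed.

Lemma pr21_E (f : L) : pr 2 1 f = f + pr 2 0 f.
Proof.
by rewrite {2}(sum_pr f (ltn0Sn 1)) !big_ord_recl big_ord0 addr0 addrAC L_addxx add0r.
Qed.

Lemma pr20_sqrM (f g : L) : pr 2 0 (f ^+ 2 * g) = f ^+ 2 * pr 2 0 g.
Proof. by rewrite pr20M pr20_sqr pr21_sqr mul0r addr0. Qed.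

(** The class of 2j modulo 2q consists of even exponents, so only p_{2,0}(f) matters, and squaring
    doubles exponents. *)
Lemma pr_half q j (f g : L) :
  pr 2 0 f = g ^+ 2 -> pr (2 * q) (2 * j) f = pr q j g ^+ 2.
Proof.
move=> fg; rewrite -pr_sqr -fg -[LHS]pr_dvd -(pr_mod 2 (2 * j)).
by rewrite modnMr.
Qed.

(** * Products of series supported on squares *)

(** The maps need to be mutually inverse only where [P] and [Q] hold, which admits maps that halve
    integers. *)
Lemma count_bij (S T : eqType) (s : seq S) (t : seq T) (P : pred S) (Q : pred T)
    (h : S -> T) (k : T -> S) : uniq s -> uniq t ->
  {in s, forall x, P x -> [&& h x \in t, Q (h x) & k (h x) == x]} ->
  {in t, forall y, Q y -> [&& k y \in s, P (k y) & h (k y) == y]} ->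
  count P s = count Q t.
Proof.
move=> us ut hP kQ; rewrite -!size_filter.
have sub : {subset map h (filter P s) <= filter Q t}.
  move=> _ /mapP[x + ->]; rewrite !mem_filter => /andP[Px xs].
  by have /and3P[-> ->] := hP x xs Px.
have bus : {subset filter Q t <= map h (filter P s)}.
  move=> y; rewrite mem_filter => /andP[Qy yt].
  have /and3P[ks Pk /eqP hk] := kQ y yt Qy.
  by apply/mapP; exists (k y); rewrite ?mem_filter ?Pk.
have uh : uniq (map h (filter P s)).
  rewrite map_inj_in_uniq ?filter_uniq // => x x'.
  rewrite !mem_filter => /andP[Px xs] /andP[Px' xs'] hxx.
  have /and3P[_ _ /eqP<-] := hP x xs Px; rewrite hxx.
  by have /and3P[_ _ /eqP->] := hP x' xs' Px'.
rewrite -(size_map h); apply/eqP; rewrite eqn_leq.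
by rewrite !uniq_leq_size ?filter_uniq.
Qed.

Lemma natr_count0 (R : nzRingType) (T : Type) (P : pred T) (s : seq T) :
  (forall x, ~~ P x) -> (count P s)%:R = 0 :> R.
Proof.
by move=> P0; have /eq_count-> : P =1 pred0; rewrite ?count_pred0 // => x; exact/negbTE.
Qed.

Definition centered (M : nat) : seq int :=
  [seq j%:Z - M%:Z | j <- iota 0 (M + M).+1].

Arguments centered : simpl never.

Lemma mem_centered M (n : int) : (n \in centered M) = (- M%:Z <= n <= M%:Z).
Proof.
apply/mapP/idP => [[j]|nM]; first by rewrite mem_iota => jM ->; lia.
by exists (absz (n + M%:Z)%R); rewrite ?mem_iota; lia.
Qed.

Lemma centered_uniq M : uniq (centered M).
Proof. by rewrite map_inj_uniq ?iota_uniq // => i j; lia. Qed.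

(* [f] is the sum of x^(w n^2) over the integers n satisfying [P]; the bound [M]
   makes the count finite. *)
Definition square_series (w : nat) (P : pred int) (f : L) :=
  forall M (N : int), `|N| <= M%:Z ->
  f N = (count (fun n => P n && (w%:Z * n ^+ 2 == N)) (centered M))%:R.

Lemma br_square_series i : square_series 1 (fun n => n == i %[mod 9])%Z (br i).
Proof.
move=> M N NM; rewrite -size_filter; set s := filter _ _.
have -> : br i N = theta_coef 'F_2 9 i N by [].
rewrite /theta_coef (fsbig_fwiden s).
- by rewrite big_const_seq count_predT iter_addr_0.
- move=> n [ni nN]; suff: n \in s by [].
  by rewrite mem_filter mul1r nN eqxx ni eqxx /= mem_centered; nia.
- by rewrite filter_uniq // centered_uniq.
- move=> n [ns []]; move: ns; rewrite /mkset mem_filter mul1r.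
  by case/andP => /andP[/eqP ni /eqP nN] _.
Qed.

Lemma square_series_sqr w P f :
  square_series w P f -> square_series (2 * w) P (f ^+ 2).
Proof.
move=> fP M N NM; rewrite sqr_coef; case: ifP => N2.
  rewrite (fP M); last by lia.
  by congr (_%:R); apply: eq_count => n; congr (_ && _); move/eqP: N2; lia.
rewrite natr_count0 // => n.
by rewrite negb_and; apply/orP; right; move/eqP: N2; lia.
Qed.

Lemma square_series_pr w P f (q j : nat) : square_series w P f ->
  square_series w (fun n => P n && (w%:Z * n ^+ 2 == j %[mod q])%Z) (pr q j f).
Proof.
move=> fP M N NM.
have -> : pr q j f N = if (N == j %[mod q])%Z then f N else 0 by [].
case: ifP => Nj.
  rewrite (fP M) //; congr (_%:R); apply: eq_count => n /=.
  by have [->|_] := eqVneq _ N; rewrite ?Nj ?andbT ?andbF.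
rewrite natr_count0 // => n /=.
by have [->|_] := eqVneq _ N; rewrite ?Nj ?andbF.
Qed.

(** Two-variable analogue of [square_series], for the binary form w m^2 + v n^2. *)
Definition square_pairs (w v : nat) (P : int -> int -> bool) (f : L) :=
  forall M (N : int), `|N| <= M%:Z ->
  f N = (count (fun z : int * int =>
    P z.1 z.2 && (w%:Z * z.1 ^+ 2 + v%:Z * z.2 ^+ 2 == N))
    [seq (m, n) | m <- centered M, n <- centered M])%:R.

Lemma square_series_ge0 w P f : square_series w P f -> vanish_lt 0 f.
Proof.
move=> fP N N0; rewrite (fP (absz N)); last by lia.
rewrite natr_count0 // => n.
by rewrite negb_and; apply/orP; right; nia.
Qed.

Lemma natr_count (R : nzRingType) (T : Type) (P : pred T) (s : seq T) :
  (count P s)%:R = \sum_(x <- s) (P x)%:R :> R.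
Proof. by elim: s => [|x s IH]; rewrite ?big_nil //= big_cons natrD IH. Qed.

Lemma square_seriesM w v P Q f g :
  square_series w P f -> square_series v Q g ->
  square_pairs w v (fun m n => P m && Q n) (f * g).
Proof.
move=> fP gQ M N NM.
have f0 := square_series_ge0 fP; have g0 := square_series_ge0 gQ.
have [N0|N0] := ltP N 0.
  rewrite (conv_vanish f0 g0 N0 : (f * g) N = 0).
  rewrite natr_count0 // => z.
  by rewrite negb_and; apply/orP; right; nia.
have [k Nk] : exists k : nat, N = k%:Z by exists (absz N); lia.
have -> : (f * g) N = conv f g (0 + 0 + k%:Z) by rewrite Nk.
rewrite (conv_sum k f0 g0) natr_count big_allpairs_dep /=.
transitivity (\sum_(i < k.+1) \sum_(m <- centered M) \sum_(n <- centered M)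
  ((P m && (w%:Z * m ^+ 2 == i%:Z)) && (Q n && (v%:Z * n ^+ 2 == (k - i)%N%:Z)))%:R : 'F_2).
  apply: eq_bigr => i _; rewrite !add0r (fP M) ?(gQ M); try by have := ltn_ord i; lia.
  rewrite !natr_count mulr_suml; apply: eq_bigr => m _.
  by rewrite mulr_sumr; apply: eq_bigr => n _; rewrite -natrM mulnb.
(* For a fixed pair (m, n) the only index that can contribute is i = w m^2, and it does so exactly
   when the form takes the value N. *)
rewrite exchange_big; apply: eq_bigr => m _; rewrite exchange_big.
apply: eq_bigr => n _ /=.
case: (P m) => /=; last by rewrite big1.
case: (Q n) => /=; last by rewrite big1 // => i _; rewrite andbF.
have [mnN|mnN] := eqVneq (w%:Z * m ^+ 2 + v%:Z * n ^+ 2) N; last first.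
  rewrite big1 // => i _; case: andP => // -[/eqP mi /eqP ni].
  by have := ltn_ord i; lia.
have mk : (absz (w%:Z * m ^+ 2)%R < k.+1)%N by nia.
rewrite (bigD1 (Ordinal mk)) //= big1 ?addr0.
  by case: andP => // -[]; split; apply/eqP; nia.
move=> i im; case: andP => // -[/eqP mi /eqP ni]; case/eqP: im.
by apply/val_inj => /=; lia.
Qed.

Lemma square_series_eq w v P Q f g (h k : int -> int) : (0 < w)%N -> (0 < v)%N ->
  square_series w P f -> square_series v Q g ->
  (forall n, P n ->
    [/\ Q (h n), v%:Z * h n ^+ 2 = w%:Z * n ^+ 2 & k (h n) = n]) ->
  (forall n, Q n ->
    [/\ P (k n), w%:Z * k n ^+ 2 = v%:Z * n ^+ 2 & h (k n) = n]) ->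
  f = g.
Proof.
move=> w0 v0 fP gQ hP kQ; apply: laurentP => N.
have NM : `|N| <= (absz N)%:Z by lia.
rewrite (fP _ _ NM) (gQ _ _ NM); congr (_%:R).
have bound (u : nat) n : (0 < u)%N -> u%:Z * n ^+ 2 = N -> n \in centered (absz N).
  by move=> u0 uN; rewrite mem_centered; nia.
apply: (count_bij (h := h) (k := k)); try exact: centered_uniq.
  move=> n _ /andP[/hP[-> vw ->] /eqP nN].
  by rewrite vw nN !eqxx !andbT (bound v) // vw.
move=> n _ /andP[/kQ[-> vw ->] /eqP nN].
by rewrite vw nN !eqxx !andbT (bound w) // vw.
Qed.

(** With positive weights all pairs of value N lie in the box of radius |N|, so [h] and [k] need not
    preserve boxes. *)
Lemma square_pairs_bij w v w' v' (P Q : int -> int -> bool) f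
    (h k : int * int -> int * int) :
  (0 < w)%N -> (0 < v)%N -> (0 < w')%N -> (0 < v')%N ->
  square_pairs w v P f ->
  (forall z, P z.1 z.2 -> [/\ Q (h z).1 (h z).2,
    w'%:Z * (h z).1 ^+ 2 + v'%:Z * (h z).2 ^+ 2 =
      w%:Z * z.1 ^+ 2 + v%:Z * z.2 ^+ 2 & k (h z) = z]) ->
  (forall z, Q z.1 z.2 -> [/\ P (k z).1 (k z).2,
    w%:Z * (k z).1 ^+ 2 + v%:Z * (k z).2 ^+ 2 =
      w'%:Z * z.1 ^+ 2 + v'%:Z * z.2 ^+ 2 & h (k z) = z]) ->
  square_pairs w' v' Q f.
Proof.
move=> w0 v0 w'0 v'0 fP hP kQ M N NM; rewrite (fP _ _ NM); congr (_%:R).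
set s := [seq (m, n) | m <- _, n <- _].
have us : uniq s.
  by apply: allpairs_uniq => [||[? ?] [? ?]]; rewrite ?centered_uniq.
have bound (u u' : nat) (z : int * int) : (0 < u)%N -> (0 < u')%N ->
    u%:Z * z.1 ^+ 2 + u'%:Z * z.2 ^+ 2 = N -> z \in s.
  case: z => m n /= u0 u'0 uN; apply/allpairsP; exists (m, n).
  by rewrite /= !mem_centered; split=> //; nia.
apply: (count_bij (h := h) (k := k)) => //.
  move=> z _ /andP[/hP[-> vw ->] /eqP zN].
  by rewrite vw zN !eqxx !andbT (bound w' v') // vw.
move=> z _ /andP[/kQ[-> vw ->] /eqP zN].
by rewrite vw zN !eqxx !andbT (bound w v) // vw.
Qed.

Lemma square_pairs_split w v P (Q : int -> int -> bool) f g h :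
  square_pairs w v P f ->
  square_pairs w v (fun m n => P m n && Q m n) g ->
  square_pairs w v (fun m n => P m n && ~~ Q m n) h ->
  f = g + h.
Proof.
move=> fP gQ hQ; apply: laurentP => N.
have NM : `|N| <= (absz N)%:Z by lia.
have -> : (g + h) N = g N + h N by [].
rewrite (fP _ _ NM) (gQ _ _ NM) (hQ _ _ NM) -natrD; congr (_%:R).
rewrite -size_filter -(count_predC (fun z : int * int => Q z.1 z.2)) !count_filter.
by congr (_ + _)%N; apply: eq_count => z /=; rewrite andbA (andbC (P _ _)).
Qed.

(** * The theta series modulo 9: symmetry, even and odd parts, lowest terms *)

Lemma br_opp i : br (- i) = br i.
Proof.
apply: (square_series_eq (h := -%R) (k := -%R) _ _ (br_square_series _)
  (br_square_series _)) => // n /eqP ni; split; rewrite ?sqrrN ?opprK //; lia.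
Qed.

Lemma br_congr i j : (i = j %[mod 9])%Z -> br i = br j.
Proof.
move=> ij; apply: (square_series_eq (h := id) (k := id) _ _ (br_square_series _)
  (br_square_series _)) => // n /eqP ni; split=> //; lia.
Qed.

Lemma br_pow4 i : square_series 4 (fun n => n == i %[mod 9])%Z (br i ^+ 4).
Proof.
rewrite (exprM _ 2 2).
exact: (square_series_sqr (square_series_sqr (br_square_series i))).
Qed.

(** An even square is (2m)^2 = 4 m^2, and 2m = 2i modulo 9 forces m = i because 2 is invertible; the
    fourth power is the series of weight 4. *)
Lemma pr20_br i : pr 2 0 (br (2 * i)) = br i ^+ 4.
Proof.
apply: (square_series_eq (h := fun n => (n %/ 2)%Z) (k := fun n => 2 * n) _ _
  (square_series_pr 2 0 (br_square_series _)) (br_pow4 i)) => // n.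
  move=> /andP[/eqP ni /eqP n2].
  have {}n2 : (n %% 2)%Z = 0.
    move: n2; rewrite mul1r expr2 -modzMm.
    by have [->|->] : (n %% 2)%Z = 0 \/ (n %% 2)%Z = 1 by lia.
  by split; [apply/eqP; lia | rewrite {2}(_ : n = 2 * (n %/ 2)%Z); lia | lia].
move=> /eqP ni; split; [|lia|lia].
by apply/andP; split; apply/eqP; [lia|rewrite mul1r exprMn -mulrA modzMr mod0z].
Qed.

Lemma pr21_br i : square_series 1
  (fun n => (n == i %[mod 9])%Z && (n == 1 %[mod 2])%Z) (pr 2 1 (br i)).
Proof.
move=> M N NM; rewrite (square_series_pr 2 1 (br_square_series i) NM).
congr (_%:R); apply: eq_count => n; congr (_ && _ && _).
by rewrite mul1r expr2 -modzMm; have [->|->] : (n %% 2)%Z = 0 \/ (n %% 2)%Z = 1 by lia.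
Qed.

(* Substituting u = a + b and v = a - b turns u^2 + v^2 into 2 a^2 + 2 b^2; the
   pairs with u and v odd are those with a + b odd, and a second such
   substitution counts the pairs with a + b even. *)
Lemma theta_addition s t : br (s + t) ^+ 2 * br (s - t) ^+ 2 =
  pr 2 1 (br (2 * s)) * pr 2 1 (br (2 * t)) + br s ^+ 4 * br t ^+ 4.
Proof.
have st := square_seriesM (square_series_sqr (br_square_series (s + t)))
  (square_series_sqr (br_square_series (s - t))).
have odd_pairs := square_seriesM (pr21_br (2 * s)) (pr21_br (2 * t)).
have even_pairs := square_seriesM (br_pow4 s) (br_pow4 t).
apply: (@square_pairs_split _ _ _ (fun m n => m + n == 1 %[mod 2])%Z _ _ _ st).
  apply: (square_pairs_bij (h := fun z => ((z.1 + z.2) %/ 2, (z.1 - z.2) %/ 2)%Z)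
    (k := fun z => (z.1 + z.2, z.1 - z.2)) _ _ _ _ odd_pairs) => //.
    move=> [u v] /= /andP[/andP[/eqP us /eqP u1] /andP[/eqP vt /eqP v1]].
    (* Both u and v are odd, so half their sum and half their difference are integers; dividing by 2
       modulo 9 puts them in the classes of s + t and s - t. *)
    have [a [b [ua ub]]] : exists a b, u = a + b /\ v = a - b.
      by exists ((u + v) %/ 2)%Z, ((u - v) %/ 2)%Z; lia.
    subst u v; have -> : ((a + b + (a - b)) %/ 2)%Z = a by clear; lia.
    have -> : ((a + b - (a - b)) %/ 2)%Z = b by clear; lia.
    split; [|clear; lia|by []].
    by apply/andP; split; [apply/andP; split|]; apply/eqP; lia.
  move=> [a b] /= /andP[/andP[/eqP ast /eqP bst] /eqP ab1].
  split; [|clear; lia|by congr (_, _); clear; lia].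
  by apply/andP; split; apply/andP; split; apply/eqP; lia.
apply: (square_pairs_bij (k := fun z => ((z.1 + z.2) %/ 2, (z.1 - z.2) %/ 2)%Z)
  (h := fun z => (z.1 + z.2, z.1 - z.2)) _ _ _ _ even_pairs) => //.
  move=> [c d] /= /andP[/eqP cs /eqP dt].
  split; [|clear; lia|by congr (_, _); clear; lia].
  by apply/andP; split; [apply/andP; split|]; lia.
move=> [a b] /= /andP[/andP[/eqP ast /eqP bst] /eqP ab1].
have [c [d [ca da]]] : exists c d, a = c + d /\ b = c - d.
  by exists ((a + b) %/ 2)%Z, ((a - b) %/ 2)%Z; lia.
subst a b; have -> : ((c + d + (c - d)) %/ 2)%Z = c by clear; lia.
have -> : ((c + d - (c - d)) %/ 2)%Z = d by clear; lia.
split; [|clear; lia|by []].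
by apply/andP; split; apply/eqP; lia.
Qed.

Lemma br_nonsquare (q j : nat) i : (forall n : int, (n ^+ 2 != j %[mod q])%Z) ->
  pr q j (br i) = 0.
Proof.
move=> nsq; apply: laurentP => N.
have NM : `|N| <= (absz N)%:Z by lia.
rewrite (square_series_pr q j (br_square_series i) NM) natr_count0.
  by rewrite /= /const_fun if_same.
by move=> n; rewrite mul1r (negPf (nsq n)) andbF.
Qed.

(** Squares are 0 or 1 modulo 4, so the even part sits in class 0 and the odd part in class 1. *)
Lemma pr4_br i : [/\ pr 4 0 (br i) = pr 2 0 (br i), pr 4 1 (br i) = pr 2 1 (br i),
  pr 4 2 (br i) = 0 & pr 4 3 (br i) = 0].
Proof.
have sq4 (n : int) : (n ^+ 2 %% 4)%Z = 0 \/ (n ^+ 2 %% 4)%Z = 1.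
  have [m [b [-> b01]]] : exists m b : int, n = 2 * m + b /\ (b = 0 \/ b = 1).
    by exists (n %/ 2)%Z, (n %% 2)%Z; lia.
  have -> : (2 * m + b) ^+ 2 = 4 * (m * m + m * b) + b ^+ 2 by ring.
  by rewrite mulrC modzMDl; case: b01 => ->; [left|right].
have h2 : pr 4 2 (br i) = 0.
  by apply: br_nonsquare => n; apply/eqP; case: (sq4 n) => ->.
have h3 : pr 4 3 (br i) = 0.
  by apply: br_nonsquare => n; apply/eqP; case: (sq4 n) => ->.
have E : br i = pr 4 0 (br i) + pr 4 1 (br i).
  rewrite {1}(sum_pr (br i) (ltn0Sn 3)) !big_ord_recl big_ord0 addr0.
  by rewrite h2 h3 !addr0.
have c0 : pr 2 0 (pr 4 0 (br i)) = pr 4 0 (br i) := pr_sub 2 2 0 (br i).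
have c1 : pr 2 1 (pr 4 1 (br i)) = pr 4 1 (br i) := pr_sub 2 2 1 (br i).
split=> //; rewrite [in RHS]E prD.
  by rewrite c0 -c1 pr_pr addr0.
by rewrite c1 -c0 pr_pr add0r.
Qed.

(** Any other member of the class is at least r + 9 or at most r - 9, and r - 9 < -r since 2r <
    9. *)
Lemma least_residue_sqr (r n : int) : 0 < r < 5 -> (n = r %[mod 9])%Z ->
  n = r \/ r ^+ 2 < n ^+ 2.
Proof.
move=> r05 nr.
have [->|[rn|nr']] : n = r \/ (r < n \/ r < - n) by lia.
- by left.
- by right; rewrite ltr_pXn2r // nnegrE; lia.
- by right; rewrite -[n ^+ 2]sqrrN ltr_pXn2r // nnegrE; lia.
Qed.

(** The lowest term comes from n = r alone; it serves to show that certain series are nonzero. *)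
Lemma br_bottom (r : int) : 0 < r < 5 ->
  vanish_lt (r ^+ 2) (br r) /\ br r (r ^+ 2) = 1.
Proof.
move=> r05; split=> [N Nr|].
  have NM : `|N| <= (absz N)%:Z by lia.
  rewrite (br_square_series r NM) natr_count0 // => n.
  rewrite mul1r; apply/negP => /andP[/eqP nr /eqP nN].
  by case: (least_residue_sqr r05 nr) => [nE|]; [move: nN; rewrite nE|rewrite nN]; lia.
have rM : `|r ^+ 2| <= (absz (r ^+ 2))%:Z by lia.
rewrite (br_square_series r rM).
rewrite (eq_count (a2 := pred1 r)) => [|n].
  rewrite (count_uniq_mem _ (centered_uniq _)) mem_centered.
  by rewrite (_ : _ <= _ <= _) //; clear rM; nia.
rewrite mul1r /=; apply/andP/eqP => [[/eqP nr /eqP nN]|-> //].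
by have [//|] := least_residue_sqr r05 nr; rewrite nN ltxx.
Qed.

(** * Polynomial identities between the thetas *)

Lemma natr_char2 (R : nzRingType) (n : nat) :
  2%:R = 0 :> R -> n%:R = (odd n)%:R :> R.
Proof.
by move=> two; rewrite -[n in LHS]odd_double_half natrD -mul2n natrM two mul0r addr0.
Qed.

Lemma char2_coefs (R : nzRingType) : 2%:R = 0 :> R ->
  [/\ 3%:R = 1 :> R, 4%:R = 0 :> R, 5%:R = 1 :> R, 6%:R = 0 :> R & 8%:R = 0 :> R].
Proof. by move=> two; split; rewrite (natr_char2 _ two). Qed.

(* [ring] uses an equation between constants only to replace that very
   coefficient, so each coefficient to be reduced mod 2 has to be listed. *)
Ltac ring_char2 two :=
  let c3 := fresh in let c4 := fresh in let c5 := fresh in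
  let c6 := fresh in let c8 := fresh in
  have [c3 c4 c5 c6 c8] := char2_coefs two; ring : two c3 c4 c5 c6 c8.

Section ThetaIdentities.
Variables (F : fieldType) (A B C D : F).
Hypothesis two : 2%:R = 0 :> F.

(** Odd parts are b + a^4, c + b^4 and D + D^4. [rel12] and [rel13] expand the products of the first
    with the second and with the third; the digits in [R12], ..., [R43] are the i, j of the product
    of the odd parts of [2i] and [2j] for r = 1. *)
Let rel12 a b c := D^+2 * a^+2 + b * c + b^+5 + c * a^+4.
Let rel13 a b c := c^+2 * b^+2 + b * D + b * D^+4 + D * a^+4.

Hypothesis R12 : rel12 A B C = 0.
Hypothesis R24 : rel12 B C A = 0.
Hypothesis R41 : rel12 C A B = 0.
Hypothesis R13 : rel13 A B C = 0.
Hypothesis R23 : rel13 B C A = 0.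
Hypothesis R43 : rel13 C A B = 0.

Let cubic := A^+2 * C + A * B^+2 + B * C^+2 + D + D^+2 + D^+3.

(* With p = A^2 C, q = A B^2, r = B C^2 and v = D + D^4, the relations give
   p^2 + p v = D q^2 cyclically; summing, s = p + q + r satisfies
   s (1 + D) (s + D + D^2 + D^3) = 0. *)
Lemma cubic_relation : A^+2 * C + A * B^+2 + B * C^+2 != 0 -> 1 + D != 0 ->
  cubic = 0.
Proof.
move=> sN0 DN1; set s := A^+2 * C + _ + _ in sN0.
have : s * (1 + D) * cubic = 0.
  transitivity (A^+2 * rel13 B C A + B^+2 * rel13 C A B + C^+2 * rel13 A B C).
    by rewrite /s /cubic /rel13; ring_char2 two.
  by rewrite R13 R23 R43 !mulr0 !addr0.
by move/eqP; rewrite !mulf_eq0 (negPf sN0) (negPf DN1) => /eqP.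
Qed.

(* Here and below, the coefficients of the relations were found by linear algebra
   over F_2. *)
Lemma halfABCD_relation :
  A * C^+2 * D + A^+2 * B * D^+3 + A * C^+2 * D^+3 + B^+3 * C^+3
    + A^+3 * B^+3 = D * (B^+2 * C + A * C^+2 + A^+2 * B).
Proof.
transitivity (D * (B^+2 * C + A * C^+2 + A^+2 * B) + (B * D * rel12 A B C
  + A * D * rel12 C A B + (B * C + A^+2) * rel13 A B C
  + B^+2 * rel13 B C A + A * B * rel13 C A B)).
  by rewrite /rel12 /rel13; ring_char2 two.
by rewrite R12 R41 R13 R23 R43 !mulr0 !addr0.
Qed.

Hypothesis K : cubic = 0.

(** Puts A G into terms that are squares times products with known even part. *)
Lemma A1G_relation : A * (D * (B^+2 * C + A * C^+2 + A^+2 * B)) =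
  C * (D^+2 + D^+3 + D^+4) + B * C^+3 * D + A^+3 * B * D.
Proof.
transitivity (C * (D^+2 + D^+3 + D^+4) + B * C^+3 * D + A^+3 * B * D
  + C * D * cubic); first by rewrite /cubic; ring_char2 two.
by rewrite K mulr0 addr0.
Qed.

(** Since G/A = A^-4 (A^3 G), the class 1 modulo 4 is computed on A^3 G; the right side splits into
    squares times short products. *)
Lemma A3G_relation : A^+3 * (D * (B^+2 * C + A * C^+2 + A^+2 * B)) =
  D^+4 * (1 + D + D^+2) + B * C^+2 * (D + D^+2) + A * B^+2 * D + B^+2 * C^+4.
Proof.
transitivity (D^+4 * (1 + D + D^+2) + B * C^+2 * (D + D^+2) + A * B^+2 * D
    + B^+2 * C^+4
  + ((A * D + A * D^+2) * rel12 B C A + A * B * rel13 A B C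
  + (A^+2 + A^+2 * D) * rel13 B C A + (A * C + A * C * D) * rel13 C A B
  + (D^+3 + B * C^+2 + A^+2 * C) * cubic)).
  by rewrite /rel12 /rel13 /cubic; ring_char2 two.
by rewrite R24 R13 R23 R43 K !mulr0 !addr0.
Qed.

(** The left side is the square root of p_{2,0}(A G); its divisibility by A is what makes
    p_{2,0}(G/A) the square of a polynomial. *)
Lemma halfA1G_relation :
  B^+2 * D + A * C * D + B^+2 * D^+2 + B^+3 * C^+2 + A^+3 * C^+2
    + A^+4 * B + A * B * C^+3 = A * (B * C^+3 + B^+4 + A^+3 * B).
Proof.
transitivity (A * (B * C^+3 + B^+4 + A^+3 * B) + (D * rel12 B C A
  + A * rel13 B C A + C * rel13 C A B + B^+2 * cubic)).
  by rewrite /rel12 /rel13 /cubic; ring_char2 two.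
by rewrite R24 R23 R43 K !mulr0 !addr0.
Qed.

(** The left side is p_{4,1}(A^3 G) as it arises term by term from the even and odd parts. *)
Lemma quarter_parts :
  D^+4 * (D + D^+4) + B^+8 * (A^+4 * (D + D^+4) + (B + A^+4) * (D^+4 + D^+8))
    + (C + B^+4)^+2 * ((B + A^+4) * (D + D^+4)^+2)
    + A^+8 * (C^+4 * (D + D^+4) + (A + C^+4) * D^+4) =
  D^+5 + D^+8 + B^+10 * C^+2 + B^+9 * D + A^+10 * B^+2 + A^+9 * D
    + A^+4 * B * C^+4 + A^+8 * C^+4.
Proof.
transitivity (D^+5 + D^+8 + B^+10 * C^+2 + B^+9 * D + A^+10 * B^+2 + A^+9 * D
  + A^+4 * B * C^+4 + A^+8 * C^+4 + (B^+8 * rel13 A B C + A^+8 * rel13 C A B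
  + (B + A^+4) * rel13 B C A ^+2)).
  by rewrite /rel13; ring_char2 two.
by rewrite R13 R43 R23 expr0n !mulr0 !addr0.
Qed.

Lemma quarter_relation :
  D^+5 + D^+8 + B^+10 * C^+2 + B^+9 * D + A^+10 * B^+2 + A^+9 * D
    + A^+4 * B * C^+4 + A^+8 * C^+4 =
  A^+4 * (C^+2 * D^+3 + A * B^+2 * C^+2 + C^+2 * D^+6 + B^+2 * C^+6).
Proof.
transitivity (
  A^+4 * (C^+2 * D^+3 + A * B^+2 * C^+2 + C^+2 * D^+6 + B^+2 * C^+6) + (
  (B * C^+4 + B^+4 * C + A^+2 * C^+3 * D^+2 + A * B * D^+2 + A^+5
    + B^+5 * C^+3) * rel13 A B C
  + (A^+4 * C^+3 + B^+4 * D + B^+5 * C^+2 + B * C^+3 * D + B * C^+3 * D^+4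
    + A^+4 * C^+3 * D + C * D^+4 + A^+2 * C^+2 * D^+2 + B^+2 * C^+5)
    * rel12 A B C
  + (B^+2 * D^+2 + A^+8) * rel13 C A B
  + (B * D^+3 + A^+4 * D + A^+4 * D^+4) * rel12 C A B
  + (D^+5 + A^+2 * C * D^+2 + A * B^+2 * D^+2 + D^+4) * cubic
  + A^+2 * D^+2 * rel13 B C A)).
  by rewrite /rel12 /rel13 /cubic; ring_char2 two.
by rewrite R12 R41 R13 R23 R43 K !mulr0 !addr0.
Qed.

End ThetaIdentities.

(** * Halving the reciprocal *)

(* Stated over an abstract field because on [L] itself [field] unfolds the
   operations on series. *)
Lemma div_sqrE (F : fieldType) (x y : F) : y != 0 -> x / y = y^-1 ^+ 2 * (y * x).
Proof. by move=> y0; field. Qed.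

Lemma sqr_divE (F : fieldType) (x y : F) : y^-1 ^+ 2 * x ^+ 2 = (x / y) ^+ 2.
Proof. by rewrite -exprMn mulrC. Qed.

Lemma div_pow4E (F : fieldType) (x y : F) :
  y != 0 -> x / y = (y^-1 ^+ 2) ^+ 2 * (y ^+ 3 * x).
Proof. by move=> y0; field. Qed.

Lemma pow4_divK (F : fieldType) (x y : F) :
  y != 0 -> (y^-1 ^+ 2) ^+ 2 * (y ^+ 4 * x) = x.
Proof. by move=> y0; field. Qed.

Lemma pow4E (F : fieldType) (x : F) : x ^+ 4 = (x ^+ 2) ^+ 2.
Proof. by ring. Qed.

Lemma pow6E (F : fieldType) (x : F) : x ^+ 2 * x ^+ 4 = (x ^+ 3) ^+ 2.
Proof. by ring. Qed.

Lemma pow16E (F : fieldType) (x : F) : (((x ^+ 2) ^+ 2) ^+ 2) ^+ 2 = x ^+ 16.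
Proof. by ring. Qed.

Lemma pow32E (F : fieldType) (x : F) : ((((x ^+ 2) ^+ 2) ^+ 2) ^+ 2) ^+ 2 = x ^+ 32.
Proof. by ring. Qed.

(** Write g/f = f^-2 (f g): the square f^-2 passes through p_{2,0}. *)
Lemma pr20_div (f g h : L) : f != 0 ->
  pr 2 0 (f * g) = h ^+ 2 -> pr 2 0 (g / f) = (h / f) ^+ 2.
Proof.
move=> f0 fgh; rewrite (div_sqrE g f0) (pr20_sqrM f^-1) fgh.
exact: sqr_divE.
Qed.

Section Reciprocal.
(** The theta relations below are permuted by A -> B -> C -> A with D fixed, so one argument serves
    r = 1, 2 and 4. *)
Variables A B C D : L.
Hypothesis A_neq0 : A != 0.
Hypothesis pr4_parts : forall X, X \in [:: A; B; C; D] ->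
  [/\ pr 4 0 X = pr 2 0 X, pr 4 1 X = pr 2 1 X, pr 4 2 X = 0 & pr 4 3 X = 0].
Hypotheses (A0 : pr 2 0 A = C ^+ 4) (B0 : pr 2 0 B = A ^+ 4).
Hypotheses (C0 : pr 2 0 C = B ^+ 4) (D0 : pr 2 0 D = D ^+ 4).
Hypothesis AB : pr 2 1 A * pr 2 1 B = C ^+ 2 * D ^+ 2 + C ^+ 4 * A ^+ 4.
Hypothesis BC : pr 2 1 B * pr 2 1 C = A ^+ 2 * D ^+ 2 + A ^+ 4 * B ^+ 4.
Hypothesis CA : pr 2 1 C * pr 2 1 A = B ^+ 2 * D ^+ 2 + B ^+ 4 * C ^+ 4.
Hypothesis AD : pr 2 1 A * pr 2 1 D = A ^+ 2 * B ^+ 2 + C ^+ 4 * D ^+ 4.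
Hypothesis BD : pr 2 1 B * pr 2 1 D = B ^+ 2 * C ^+ 2 + A ^+ 4 * D ^+ 4.
Hypothesis CD : pr 2 1 C * pr 2 1 D = C ^+ 2 * A ^+ 2 + B ^+ 4 * D ^+ 4.

Let A1 : pr 2 1 A = A + C ^+ 4. Proof. by rewrite pr21_E A0. Qed.
Let B1 : pr 2 1 B = B + A ^+ 4. Proof. by rewrite pr21_E B0. Qed.
Let C1 : pr 2 1 C = C + B ^+ 4. Proof. by rewrite pr21_E C0. Qed.
Let D1 : pr 2 1 D = D + D ^+ 4. Proof. by rewrite pr21_E D0. Qed.

Let R12 : D^+2 * A^+2 + B * C + B^+5 + C * A^+4 = 0.
Proof.
transitivity (pr 2 1 B * pr 2 1 C + (A ^+ 2 * D ^+ 2 + A ^+ 4 * B ^+ 4)).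
  by rewrite B1 C1; ring_char2 L_two.
by rewrite BC L_addxx.
Qed.

Let R24 : D^+2 * B^+2 + C * A + C^+5 + A * B^+4 = 0.
Proof.
transitivity (pr 2 1 C * pr 2 1 A + (B ^+ 2 * D ^+ 2 + B ^+ 4 * C ^+ 4)).
  by rewrite C1 A1; ring_char2 L_two.
by rewrite CA L_addxx.
Qed.

Let R41 : D^+2 * C^+2 + A * B + A^+5 + B * C^+4 = 0.
Proof.
transitivity (pr 2 1 A * pr 2 1 B + (C ^+ 2 * D ^+ 2 + C ^+ 4 * A ^+ 4)).
  by rewrite A1 B1; ring_char2 L_two.
by rewrite AB L_addxx.
Qed.

Let R13 : C^+2 * B^+2 + B * D + B * D^+4 + D * A^+4 = 0.
Proof.
transitivity (pr 2 1 B * pr 2 1 D + (B ^+ 2 * C ^+ 2 + A ^+ 4 * D ^+ 4)).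
  by rewrite B1 D1; ring_char2 L_two.
by rewrite BD L_addxx.
Qed.

Let R23 : A^+2 * C^+2 + C * D + C * D^+4 + D * B^+4 = 0.
Proof.
transitivity (pr 2 1 C * pr 2 1 D + (C ^+ 2 * A ^+ 2 + B ^+ 4 * D ^+ 4)).
  by rewrite C1 D1; ring_char2 L_two.
by rewrite CD L_addxx.
Qed.

Let R43 : B^+2 * A^+2 + A * D + A * D^+4 + D * C^+4 = 0.
Proof.
transitivity (pr 2 1 A * pr 2 1 D + (A ^+ 2 * B ^+ 2 + C ^+ 4 * D ^+ 4)).
  by rewrite A1 D1; ring_char2 L_two.
by rewrite AD L_addxx.
Qed.

Lemma cubic_theta : A^+2 * C + A * B^+2 + B * C^+2 != 0 -> 1 + D != 0 ->
  A^+2 * C + A * B^+2 + B * C^+2 + D + D^+2 + D^+3 = 0.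
Proof. exact: cubic_relation L_two R13 R23 R43. Qed.

Hypothesis K : A^+2 * C + A * B^+2 + B * C^+2 + D + D^+2 + D^+3 = 0.

Let G := D * (B^+2 * C + A * C^+2 + A^+2 * B).

Lemma pr20_AC : pr 2 0 (A * C) = (B * D) ^+ 2.
Proof. by rewrite pr20M A0 C0 mulrC [X in _ + X]mulrC CA; ring_char2 L_two. Qed.

Lemma pr20_ABCD : pr 2 0 (A * B * (C * D)) = G ^+ 2.
Proof.
rewrite /G -(halfABCD_relation L_two R12 R41 R13 R23 R43).
rewrite !pr20M !pr21M A0 B0 C0 D0.
(* Only products with an even number of odd parts survive; these are paired so that the known
   products apply. *)
transitivity ((C^+4 * A^+4 + pr 2 1 A * pr 2 1 B)
    * (B^+4 * D^+4 + pr 2 1 C * pr 2 1 D)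
  + C^+4 * B^+4 * (pr 2 1 B * pr 2 1 D) + C^+4 * D^+4 * (pr 2 1 B * pr 2 1 C)
  + A^+4 * B^+4 * (pr 2 1 A * pr 2 1 D) + A^+4 * D^+4 * (pr 2 1 C * pr 2 1 A)).
  ring.
by rewrite AB BC CA AD BD CD; ring_char2 L_two.
Qed.

Lemma pr20_BCD : pr 2 0 (B * (C * D)) = (A^+3 * C + C * B^+3 + A * D^+3) ^+ 2.
Proof.
rewrite !pr20M !pr21M B0 C0 D0.
transitivity (A^+4 * (B^+4 * D^+4 + pr 2 1 C * pr 2 1 D)
  + B^+4 * (pr 2 1 B * pr 2 1 D) + D^+4 * (pr 2 1 B * pr 2 1 C)).
  ring.
by rewrite BC BD CD; ring_char2 L_two.
Qed.

Lemma pr20_ABD : pr 2 0 (A * (B * D)) = (C^+3 * B + A^+3 * B + C * D^+3) ^+ 2.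
Proof.
rewrite !pr20M !pr21M A0 B0 D0.
transitivity (C^+4 * (A^+4 * D^+4 + pr 2 1 B * pr 2 1 D)
  + A^+4 * (pr 2 1 A * pr 2 1 D) + D^+4 * (pr 2 1 A * pr 2 1 B)).
  ring.
by rewrite AB BD AD; ring_char2 L_two.
Qed.

Lemma pr20_AG :
  pr 2 0 (A * G) = (A * (B * C^+3 + B^+4 + A^+3 * B)) ^+ 2.
Proof.
rewrite -(halfA1G_relation L_two R24 R23 R43 K) /G (A1G_relation L_two K).
(* Explicit squares are factored out of each term, to be pulled through p_{2,0}. *)
have -> : C * (D^+2 + D^+3 + D^+4) + B * C^+3 * D + A^+3 * B * D =
    D^+2 * C + (D^+2 * (C * D) + ((D^+2)^+2 * C
      + (C^+2 * (B * (C * D)) + A^+2 * (A * (B * D))))) by ring.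
rewrite !prD (pr20_sqrM D C) (pr20_sqrM D) (pr20_sqrM (D^+2)) (pr20_sqrM C).
rewrite (pr20_sqrM A) pr20_BCD pr20_ABD (pr20M C) C0 D0 CD.
by ring_char2 L_two.
Qed.

(** Multiplying the four arguments by A^2 gives A, A C^2, A C^3 and ABCD, with even parts C^4, C^6,
    (BCD)^2 and G^2. *)
Let halves : [/\ pr 2 0 A^-1 = (C^+2 / A) ^+ 2,
  pr 2 0 (C^+2 / A) = (C^+3 / A) ^+ 2,
  pr 2 0 (C^+3 / A) = (C * (B * D) / A) ^+ 2 &
  pr 2 0 (C * (B * D) / A) = (G / A) ^+ 2].
Proof.
split.
- rewrite -[in LHS](div1r A); apply: pr20_div A_neq0 _.
  by rewrite mulr1 A0; exact: pow4E.
- apply: pr20_div A_neq0 _.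
  by rewrite [A * _]mulrC (pr20_sqrM C) A0; exact: pow6E.
- apply: pr20_div A_neq0 _.
  rewrite (exprSr C 2) [A * _]mulrCA (pr20_sqrM C) pr20_AC.
  by rewrite -exprMn.
- apply: pr20_div A_neq0 _.
  have -> : A * (C * (B * D)) = A * B * (C * D) by ring.
  exact: pr20_ABCD.
Qed.

Lemma pr32_0_inv :
  pr 32 0 A^-1 = (B * C^+3 + B^+4 + A^+3 * B) ^+ 32.
Proof.
have [h1 h2 h3 h4] := halves.
rewrite (pr_half 16 0 h1) (pr_half 8 0 h2) (pr_half 4 0 h3) (pr_half 2 0 h4).
(* In the fifth halving the factor A of the numerator cancels the denominator. *)
rewrite (pr20_div A_neq0 pr20_AG) (mulrC A) (mulfK A_neq0).
exact: pow32E.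
Qed.

Let pr4_sqr (f : L) : [/\ pr 4 0 (f ^+ 2) = pr 2 0 f ^+ 2, pr 4 1 (f ^+ 2) = 0,
  pr 4 2 (f ^+ 2) = pr 2 1 f ^+ 2 & pr 4 3 (f ^+ 2) = 0].
Proof.
have s1 : pr 2 1 (pr 4 1 (f ^+ 2)) = pr 4 1 (f ^+ 2) := pr_sub 2 2 1 _.
have s3 : pr 2 3 (pr 4 3 (f ^+ 2)) = pr 4 3 (f ^+ 2) := pr_sub 2 2 3 _.
have d j : pr 4 j (pr 2 j (f ^+ 2)) = pr 4 j (f ^+ 2) := pr_dvd 2 2 j _.
split; first exact: (pr_sqr 2 0).
- by rewrite -d pr21_sqr pr0.
- exact: (pr_sqr 2 1).
- by rewrite -d -(pr_mod 2 3) pr21_sqr pr0.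
Qed.

(** A square lives in classes 0 and 2 modulo 4, which reach class 1 only with classes 1 and 3 of the
    other factor. *)
Lemma pr41_sqrM (f g : L) : pr 4 1 (f ^+ 2 * g) =
  pr 2 0 f ^+ 2 * pr 4 1 g + pr 2 1 f ^+ 2 * pr 4 3 g.
Proof.
by rewrite pr41M; have [-> -> -> ->] := pr4_sqr f; rewrite !mul0r !addr0.
Qed.

(** The exponents of f^-4 are multiples of 4, so it passes through p_{4,1}. *)
Lemma pr41_div (f g h : L) : f != 0 ->
  pr 4 1 (f ^+ 3 * g) = f ^+ 4 * h -> pr 4 1 (g / f) = h.
Proof.
move=> f0 fgh; rewrite (div_pow4E g f0) (pr41_sqrM (f^-1 ^+ 2)) fgh.
rewrite pr20_sqr pr21_sqr (expr0n _ 2) mul0r addr0.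
exact: pow4_divK.
Qed.

Lemma pr41_A3G : pr 4 1 (A^+3 * G) =
  A^+4 * (C^+2 * D^+3 + A * B^+2 * C^+2 + C^+2 * D^+6 + B^+2 * C^+6).
Proof.
have [a0 a1 a2 a3] : [/\ pr 4 0 A = pr 2 0 A, pr 4 1 A = pr 2 1 A, pr 4 2 A = 0
    & pr 4 3 A = 0] by apply: pr4_parts; rewrite !inE eqxx.
have [b0 b1 b2 b3] : [/\ pr 4 0 B = pr 2 0 B, pr 4 1 B = pr 2 1 B, pr 4 2 B = 0
    & pr 4 3 B = 0] by apply: pr4_parts; rewrite !inE eqxx ?orbT.
have [d0 d1 d2 d3] : [/\ pr 4 0 D = pr 2 0 D, pr 4 1 D = pr 2 1 D, pr 4 2 D = 0
    & pr 4 3 D = 0] by apply: pr4_parts; rewrite !inE eqxx ?orbT.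
have [s0 s1 s2 s3] := pr4_sqr D.
rewrite -(quarter_relation L_two R12 R41 R13 R23 R43 K) /G
  (A3G_relation L_two R24 R13 R23 R43 K).
rewrite -(quarter_parts L_two R13 R23 R43).
(* Each term becomes a square times a factor; 1 is written as a square so that its class 1 part
   vanishes. *)
have -> : D^+4 * (1 + D + D^+2) + B * C^+2 * (D + D^+2) + A * B^+2 * D
    + B^+2 * C^+4 = (D^+2)^+2 * (1^+2 + (D + D^+2)) + (C^+2 * (B * (D + D^+2))
    + (B^+2 * (A * D) + (B * C^+2)^+2)) by ring.
have hD : pr 4 1 (1 ^+ 2 + (D + D^+2)) = pr 2 1 D.
  by rewrite !prD; have [_ -> _ _] := pr4_sqr 1; rewrite s1 d1 add0r addr0.
have hB1 : pr 4 1 (B * (D + D^+2)) =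
    pr 2 0 B * pr 2 1 D + pr 2 1 B * (pr 2 0 D + pr 2 0 D ^+ 2).
  by rewrite pr41M !prD b0 b1 b2 b3 d0 d1 s0 s1 !mul0r !addr0.
have hB3 : pr 4 3 (B * (D + D^+2)) = pr 2 1 B * pr 2 1 D ^+ 2.
  by rewrite pr43M !prD b0 b1 b2 b3 d2 d3 s2 s3 !mul0r !addr0 mulr0 !add0r.
have hA1 : pr 4 1 (A * D) = pr 2 0 A * pr 2 1 D + pr 2 1 A * pr 2 0 D.
  by rewrite pr41M a0 a1 a2 a3 d0 d1 !mul0r !addr0.
have hA3 : pr 4 3 (A * D) = 0.
  by rewrite pr43M a0 a1 a2 a3 d2 d3 !mul0r !mulr0 !addr0.
have [_ hBC _ _] := pr4_sqr (B * C^+2).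
rewrite !prD (pr41_sqrM (D^+2)) (pr41_sqrM C) (pr41_sqrM B) hD hB1 hB3 hA1 hA3 hBC.
rewrite (pr20_sqr D) (pr21_sqr D) A0 B0 C0 D0 A1 B1 C1 D1.
by ring.
Qed.

Lemma pr64_16_inv : pr 64 16 A^-1 =
  (C^+2 * D^+3 + A * B^+2 * C^+2 + C^+2 * D^+6 + B^+2 * C^+6) ^+ 16.
Proof.
have [h1 h2 h3 h4] := halves.
(* Four halvings lead from class 16 modulo 64 to class 1 modulo 4. *)
rewrite (pr_half 32 8 h1) (pr_half 16 4 h2) (pr_half 8 2 h3) (pr_half 4 1 h4).
rewrite (pr41_div A_neq0 pr41_A3G).
exact: pow16E.
Qed.

End Reciprocal.

(** * Specialisation to the four thetas and membership in [Sring] *)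

Lemma br_eq i j : (i = j %[mod 9])%Z \/ (i = - j %[mod 9])%Z -> br i = br j.
Proof. by case=> /br_congr-> //; rewrite br_opp. Qed.

(** The addition formula solved for the product of odd parts, with indices renamed up to sign modulo
    9. *)
Lemma br_odd_mul i j m n k l : br (2 * i) = br m -> br (2 * j) = br n ->
  br (i + j) = br k -> br (i - j) = br l ->
  pr 2 1 (br m) * pr 2 1 (br n) =
  br k ^+ 2 * br l ^+ 2 + br i ^+ 4 * br j ^+ 4.
Proof.
by move=> <- <- <- <-; rewrite theta_addition -addrA L_addxx addr0.
Qed.

Lemma br_even i m : br (2 * i) = br m -> pr 2 0 (br m) = br i ^+ 4.
Proof. by move=> <-; exact: pr20_br. Qed.

(** Membership is tested in each subalgebra containing the generators; closure under linear
    combinations is used with scalar 1. *)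
Lemma SringD f g : Sring f -> Sring g -> Sring (f + g).
Proof.
move=> Sf Sg A AS; have [[_ lin _] _] := AS.
have := lin 1 f g; rewrite !inE scale1r; apply; [exact: Sf|exact: Sg].
Qed.

Lemma SringM f g : Sring f -> Sring g -> Sring (f * g).
Proof.
move=> Sf Sg A AS; have [[_ _ mul] _] := AS.
have := mul f g; rewrite !inE; apply; [exact: Sf|exact: Sg].
Qed.

Lemma SringX f n : Sring f -> Sring (f ^+ n).
Proof.
move=> Sf; elim: n => [|n IH]; last by rewrite exprS; exact: SringM.
by move=> A [[A1 _ _] _]; rewrite expr0; rewrite inE in A1.
Qed.

Lemma Sring_br i : i \in [:: 1; 2; 3; 4] -> Sring (br i).
Proof.
rewrite !inE => i1234 A [_]; apply; case/or4P: i1234 => /eqP-> /=; tauto.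
Qed.

Theorem theorem6p4 (r : int) (hr : r = 1 \/ r = 2 \/ r = 4) :
  let a : L := br r in
  Sring (pr 32 0 a^-1) /\ Sring (pr 64 16 a^-1).
Proof.
set A := br 1; set B := br 2; set C := br 4; set D := br 3.
(* Modulo 9, 2 * 4 = -1 and 2 * 3 = -3, so doubling permutes A, B, C cyclically and fixes D. *)
have e2A : br (2 * 4) = A by apply: br_eq; right.
have e2B : br (2 * 1) = B by apply: br_eq; left.
have e2C : br (2 * 2) = C by apply: br_eq; left.
have e2D : br (2 * 3) = D by apply: br_eq; right.
have A0 : pr 2 0 A = C ^+ 4 := br_even e2A.
have B0 : pr 2 0 B = A ^+ 4 := br_even e2B.
have C0 : pr 2 0 C = B ^+ 4 := br_even e2C.
have D0 : pr 2 0 D = D ^+ 4 := br_even e2D.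
have AB : pr 2 1 A * pr 2 1 B = C ^+ 2 * D ^+ 2 + C ^+ 4 * A ^+ 4.
  by apply: (br_odd_mul e2A e2B); apply: br_eq; [right|left].
have BC : pr 2 1 B * pr 2 1 C = A ^+ 2 * D ^+ 2 + A ^+ 4 * B ^+ 4.
  rewrite [A ^+ 2 * _]mulrC.
  by apply: (br_odd_mul e2B e2C); apply: br_eq; [left|right].
have CA : pr 2 1 C * pr 2 1 A = B ^+ 2 * D ^+ 2 + B ^+ 4 * C ^+ 4.
  rewrite [B ^+ 2 * _]mulrC.
  by apply: (br_odd_mul e2C e2A); apply: br_eq; right.
have AD : pr 2 1 A * pr 2 1 D = A ^+ 2 * B ^+ 2 + C ^+ 4 * D ^+ 4.
  rewrite [A ^+ 2 * _]mulrC.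
  by apply: (br_odd_mul e2A e2D); apply: br_eq; [right|left].
have BD : pr 2 1 B * pr 2 1 D = B ^+ 2 * C ^+ 2 + A ^+ 4 * D ^+ 4.
  rewrite [B ^+ 2 * _]mulrC.
  by apply: (br_odd_mul e2B e2D); apply: br_eq; [left|right].
have CD : pr 2 1 C * pr 2 1 D = C ^+ 2 * A ^+ 2 + B ^+ 4 * D ^+ 4.
  by apply: (br_odd_mul e2C e2D); apply: br_eq; right.
have [A_lt A_1] := @br_bottom 1 isT.
have [B_lt B_1] := @br_bottom 2 isT.
have [C_lt C_1] := @br_bottom 4 isT.
have [D_lt _] := @br_bottom 3 isT.
have neq0 (f : L) n : f n = 1 -> f != 0.
  by move=> fn; apply/eqP => f0; move: fn; rewrite f0 /= /const_fun if_same.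
have K : A^+2 * C + A * B^+2 + B * C^+2 + D + D^+2 + D^+3 = 0.
  apply: (cubic_theta A0 B0 C0 D0 AD BD CD); last first.
    (* D starts at x^9, so 1 + D has constant term 1. *)
    apply: (neq0 _ 0); have -> : (1 + D) 0 = (1 : L) 0 + D 0 by [].
    by rewrite D_lt // addr0 /= /const_fun eqxx.
  (* The lowest exponents of A^2 C, A B^2 and B C^2 are at least 18, 9 and 36, so x^9 comes only
     from A B^2. *)
  apply: (neq0 _ 9).
  have A2C_lt : vanish_lt 18 (A^+2 * C) := conv_vanish (conv_vanish A_lt A_lt) C_lt.
  have BC2_lt : vanish_lt 36 (B * C^+2) := conv_vanish B_lt (conv_vanish C_lt C_lt).
  have B2_lt : vanish_lt 8 (B^+2) := conv_vanish B_lt B_lt.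
  have B2_8 : (B^+2) 8 = 1 by rewrite [LHS](coefM_bottom B_lt B_lt) B_1 mulr1.
  have AB2_9 : (A * B^+2) 9 = 1.
    by rewrite [LHS](coefM_bottom A_lt B2_lt) A_1 B2_8 mulr1.
  have -> : (A^+2 * C + A * B^+2 + B * C^+2) 9 =
    (A^+2 * C) 9 + (A * B^+2) 9 + (B * C^+2) 9 by [].
  by rewrite A2C_lt // BC2_lt // AB2_9 add0r addr0.
have parts X : X \in [:: A; B; C; D] -> [/\ pr 4 0 X = pr 2 0 X,
    pr 4 1 X = pr 2 1 X, pr 4 2 X = 0 & pr 4 3 X = 0].
  by rewrite !inE => /or4P[] /eqP->; exact: pr4_br.
have [SA SB SC SD] : [/\ Sring A, Sring B, Sring C & Sring D].
  by split; exact: Sring_br.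
(* Stated for arbitrary a, b, c to cover the three rotations of (A, B, C). *)
have Sp (a b c : L) : Sring a -> Sring b -> Sring c ->
    Sring ((b * c^+3 + b^+4 + a^+3 * b) ^+ 32) /\
    Sring ((c^+2 * D^+3 + a * b^+2 * c^+2 + c^+2 * D^+6 + b^+2 * c^+6) ^+ 16).
  by move=> Sa Sb Sc; split; do ?[apply: SringX | apply: SringD | apply: SringM].
case: hr => [->|[->|->]] a.
- have A_neq0 := neq0 _ _ A_1.
  rewrite (pr32_0_inv A_neq0 A0 B0 C0 D0 AB BC CA AD BD CD K).
  rewrite (pr64_16_inv A_neq0 parts A0 B0 C0 D0 AB BC CA AD BD CD K).
  exact: Sp.
- have B_neq0 := neq0 _ _ B_1.
  have K' : B^+2 * A + B * C^+2 + C * A^+2 + D + D^+2 + D^+3 = 0 by rewrite -[RHS]K; ring.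
  rewrite (pr32_0_inv B_neq0 B0 C0 A0 D0 BC CA AB BD CD AD K').
  rewrite (pr64_16_inv B_neq0 _ B0 C0 A0 D0 BC CA AB BD CD AD K').
    exact: Sp.
  by move=> X; rewrite !inE => /or4P[] /eqP->; exact: pr4_br.
- have C_neq0 := neq0 _ _ C_1.
  have K' : C^+2 * B + C * A^+2 + A * B^+2 + D + D^+2 + D^+3 = 0.
    by rewrite -[RHS]K; ring.
  rewrite (pr32_0_inv C_neq0 C0 A0 B0 D0 CA AB BC CD AD BD K').
  rewrite (pr64_16_inv C_neq0 _ C0 A0 B0 D0 CA AB BC CD AD BD K').
    exact: Sp.
  by move=> X; rewrite !inE => /or4P[] /eqP->; exact: pr4_br.
Qed.
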